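(* Let $n\ge1$, $\varepsilon\ne0$, let $\Omega\subseteq\mathbb{R}^{2n}$ be a bounded domain, $H\in C^1(\overline\Omega)$ and $\sigma\in[0,1]$, and let $u\in C^3(\Omega)\cap C^1(\overline\Omega)$ solve $$\operatorname{div}\left(\frac{Du+\sigma X}{\sqrt{\varepsilon^2+|Du+\sigma X|^2}}\right)=\sigma H\quad\text{in }\Omega.$$ Then there exists $C>0$ depending only on $n,\varepsilon,\|u\|_{L^\infty(\Omega)},\|H\|_{C^1(\overline\Omega)},\|X\|_{L^\infty(\Omega)}$ (thus independent of $\sigma\in[0,1]$) such that $$\|Du\|_{L^\infty(\Omega)}\le C\left(\|Du\|_{L^\infty(\partial\Omega)}+1\right).$$
   Context: Points of $\mathbb{R}^{2n}$ are $z=(x,y)$, $x,y\in\mathbb{R}^n$; $X(x,y)=(-y,x)$. $D$, $|\cdot|$, $\operatorname{div}$ are Euclidean. *)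

(* Defs.v *)
(* Points of R^(2n) are row vectors 'rV[R]_(n+n),
   z = row_mx x y with x = lsubmx z, y = rsubmx z. *)
From HB Require Import structures.
From mathcomp Require Import all_boot all_order all_algebra.
From mathcomp Require Import all_classical all_reals all_analysis.
Set Implicit Arguments. Unset Strict Implicit. Unset Printing Implicit Defensive.
Import Order.TTheory GRing.Theory Num.Theory.
Import numFieldNormedType.Exports.
Local Open Scope classical_set_scope.
Local Open Scope ring_scope.

Section Defs.
Variable R : realType.

Definition esq (m : nat) (v : 'rV[R]_m) : R := \sum_(i < m) (v 0 i) ^+ 2.
Definition enorm (m : nat) (v : 'rV[R]_m) : R := Num.sqrt (esq v).

Definition pd (m : nat) (f : 'rV[R]_m -> R) (i : 'I_m) (z : 'rV[R]_m) : R :=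
  'D_(delta_mx 0 i) f z.

Definition grad (m : nat) (f : 'rV[R]_m -> R) (z : 'rV[R]_m) : 'rV[R]_m :=
  \row_i pd f i z.

Definition divg (m : nat) (F : 'rV[R]_m -> 'rV[R]_m) (z : 'rV[R]_m) : R :=
  \sum_(i < m) pd (fun w => F w 0 i) i z.

Fixpoint Ck (m : nat) (k : nat) (A : set 'rV[R]_m) (f : 'rV[R]_m -> R) : Prop :=
  match k with
  | 0 => {within A, continuous f}
  | k'.+1 => (forall z, A z -> differentiable f z) /\
             (forall i : 'I_m, Ck k' A (pd f i))
  end.

(* f in C^1(closure A) with G the continuous extension of Df to closure A *)
Definition C1bar (m : nat) (A : set 'rV[R]_m) (f : 'rV[R]_m -> R)
    (G : 'rV[R]_m -> 'rV[R]_m) : Prop :=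
  Ck 1 A f /\ {within closure A, continuous f} /\
  {within closure A, continuous G} /\ (forall z, A z -> G z = grad f z).

Definition bounded_domain (m : nat) (A : set 'rV[R]_m) : Prop :=
  A !=set0 /\ open A /\ connected A /\ bounded_set A.

Definition Xf (n : nat) (z : 'rV[R]_(n + n)) : 'rV[R]_(n + n) :=
  row_mx (- rsubmx z) (lsubmx z).

End Defs.

(* Main.v *)
(* Bernstein's method.  Put V = Du + sigma X and P = eps^2 + |V|^2, and maximise
   P G(u) over the closure of the domain, where G is a fast growing function of u.
   At an interior maximum, differentiate the equation along V and contract the
   Hessian of P G(u) with the coefficients P I - V V^T: the third derivatives
   of u cancel and the second derivatives leave P |DV|^2 - |DV^T V|^2 >= 0.  As DX
   is skew and constant, the terms in X are of order at most |V|.  What remains is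
   K eps^2 (ln G)' |Du|^2 <= C (ln G)' P (for |Du| large), which bounds |Du| when K
   is large; here G(s) = exp(exp(K(s + N))).  Otherwise the maximum lies on the
   boundary, and comparing P G(u) at the maximum and at z gives the estimate. *)
Require Import Defs.
From HB Require Import structures.
From mathcomp Require Import all_boot all_order all_algebra.
From mathcomp Require Import all_classical all_reals all_analysis.
From mathcomp Require Import ring lra.
Set Implicit Arguments. Unset Strict Implicit. Unset Printing Implicit Defensive.
Import Order.TTheory GRing.Theory Num.Theory.
Import numFieldNormedType.Exports.
Local Open Scope classical_set_scope.
Local Open Scope ring_scope.

(** * Inner products, quadratic forms, and the algebra at a critical point *)

Definition dotrv {R : comPzRingType} {m : nat} (v w : 'rV[R]_m) : R :=
  (v *m w^T) 0 0.

Section DotProduct.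
Context {R : realFieldType} {m : nat}.
Implicit Types (u v w : 'rV[R]_m) (M A : 'M[R]_m) (c : R).

Lemma dotrvE v w : dotrv v w = \sum_i v 0 i * w 0 i.
Proof. by rewrite /dotrv mxE; apply: eq_bigr => i _; rewrite mxE. Qed.

Lemma dotrvC v w : dotrv v w = dotrv w v.
Proof. by rewrite !dotrvE; apply: eq_bigr => i _; rewrite mulrC. Qed.

Lemma dotrvDl u v w : dotrv (u + v) w = dotrv u w + dotrv v w.
Proof. by rewrite /dotrv mulmxDl mxE. Qed.

Lemma dotrvDr u v w : dotrv u (v + w) = dotrv u v + dotrv u w.
Proof. by rewrite dotrvC dotrvDl !(dotrvC u). Qed.

Lemma dotrvZl c v w : dotrv (c *: v) w = c * dotrv v w.
Proof. by rewrite /dotrv -scalemxAl mxE. Qed.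

Lemma dotrvZr c v w : dotrv v (c *: w) = c * dotrv v w.
Proof. by rewrite dotrvC dotrvZl dotrvC. Qed.

Lemma dotrvNl v w : dotrv (- v) w = - dotrv v w.
Proof. by rewrite -scaleN1r dotrvZl mulN1r. Qed.

Lemma dotrv_mull v w M : dotrv (v *m M) w = dotrv v (w *m M^T).
Proof. by rewrite /dotrv trmx_mul trmxK mulmxA. Qed.

Lemma dotrv_ge0 v : 0 <= dotrv v v.
Proof. by rewrite dotrvE; apply: sumr_ge0 => i _; rewrite -expr2 sqr_ge0. Qed.

Lemma dotrv_delta w i : dotrv w (delta_mx 0 i) = w 0 i.
Proof.
rewrite dotrvE (bigD1 i) //= mxE !eqxx mulr1 big1 ?addr0 // => j ji.
by rewrite mxE (negPf ji) andbF mulr0.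
Qed.

Lemma dotrv_delta_mul M i j : dotrv (delta_mx 0 i *m M) (delta_mx 0 j) = M i j.
Proof. by rewrite dotrv_delta -rowE mxE. Qed.

Lemma dotrv_skew v J : J^T = - J -> dotrv (v *m J) v = 0.
Proof.
move=> skJ; have := dotrv_mull v v J.
rewrite skJ mulmxN (dotrvC v) dotrvNl => e.
by move: e; lra.
Qed.

Lemma mxtrace_dyad v : \tr (v^T *m v) = dotrv v v.
Proof. by rewrite mxtrace_mulC trace_mx11. Qed.

Lemma dotrv_dyad v w : dotrv (v *m (w^T *m w)) v = dotrv w v ^+ 2.
Proof.
rewrite /dotrv mulmxA -(mulmxA _ w) [LHS]mxE big_ord_recl big_ord0 addr0.
by rewrite -/(dotrv v w) -/(dotrv w v) (dotrvC v w).
Qed.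

Lemma dotrv_sumE M v w :
  dotrv (v *m M) w = \sum_i \sum_j v 0 i * M i j * w 0 j.
Proof.
rewrite dotrvE exchange_big /=; apply: eq_bigr => j _.
by rewrite mxE mulr_suml.
Qed.

Lemma Cauchy_Schwarz_dotrv v w : dotrv v w ^+ 2 <= dotrv v v * dotrv w w.
Proof.
set a := dotrv v v; set b := dotrv v w; set c := dotrv w w.
have key x y : 0 <= x ^+ 2 * a + 2 * x * y * b + y ^+ 2 * c.
  have := dotrv_ge0 (x *: v + y *: w).
  rewrite !(dotrvDl, dotrvDr, dotrvZl, dotrvZr) (dotrvC w v) -/a -/b -/c.
  by lra.
have a0 : 0 <= a by apply: dotrv_ge0.
have [a_eq0|an0] := eqVneq a 0.
  (* For [a = 0] this choice gives [0 <= - (c + 2) * b ^+ 2] with [c >= 0], so [b] vanishes. *)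
  have := key (- (c + 1)) b; rewrite a_eq0.
  have c0 : 0 <= c by apply: dotrv_ge0.
  by have := mulr_ge0 c0 (sqr_ge0 b); have := sqr_ge0 b; lra.
have a_gt0 : 0 < a by rewrite lt_neqAle eq_sym an0.
have := key (- b) a.
have -> : (- b) ^+ 2 * a + 2 * - b * a * b + a ^+ 2 * c = a * (a * c - b ^+ 2).
  by ring.
by rewrite pmulr_rge0 // subr_ge0.
Qed.

(** Cauchy-Schwarz on each column of [A]; the trace is the squared Frobenius norm. *)
Lemma sumr_sqr_dotrv (v : 'rV[R]_m) A :
  dotrv (v *m A) (v *m A) <= dotrv v v * \tr (A^T *m A).
Proof.
rewrite dotrvE /mxtrace mulr_sumr; apply: ler_sum => i _.
have -> : (A^T *m A) i i = dotrv (col i A)^T (col i A)^T.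
  by rewrite mxE dotrvE; apply: eq_bigr => j _; rewrite !mxE.
apply: le_trans (Cauchy_Schwarz_dotrv _ _).
rewrite -expr2 (_ : (v *m A) 0 i = dotrv v (col i A)^T) //.
by rewrite dotrvE mxE; apply: eq_bigr => j _; rewrite !mxE.
Qed.

(* Sum the form over the vectors [V_i e_j - V_j e_i]. *)
Lemma nonpos_form_trace V M : (forall v, dotrv (v *m M) v <= 0) ->
  dotrv V V * \tr M <= dotrv (V *m M) V.
Proof.
move=> Mle0; pose e i : 'rV[R]_m := delta_mx 0 i.
pose x i j := V 0 i *: e j - V 0 j *: e i.
have xE i j : dotrv (x i j *m M) (x i j) = V 0 i ^+ 2 * M j j
   + V 0 j ^+ 2 * M i i - (V 0 i * M j i * V 0 j + V 0 j * M i j * V 0 i).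
  rewrite /x mulmxBl -!scalemxAl -!scaleNr !(dotrvDl, dotrvDr, dotrvZl, dotrvZr).
  rewrite !dotrv_delta_mul.
  by ring.
have : \sum_i \sum_j dotrv (x i j *m M) (x i j) <= 0.
  by apply: sumr_le0 => i _; apply: sumr_le0 => j _.
have -> : \sum_i \sum_j dotrv (x i j *m M) (x i j) =
          2 * (dotrv V V * \tr M - dotrv (V *m M) V).
  under eq_bigr => i _ do under eq_bigr => j _ do rewrite xE.
  under eq_bigr => i _ do rewrite sumrB !big_split /=.
  rewrite sumrB !big_split /=.
  have -> : \sum_i \sum_j V 0 i ^+ 2 * M j j = dotrv V V * \tr M.
    rewrite dotrvE /mxtrace mulr_suml; apply: eq_bigr => i _.
    by rewrite -expr2 mulr_sumr.
  have -> : \sum_i \sum_j V 0 j ^+ 2 * M i i = dotrv V V * \tr M.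
    rewrite exchange_big dotrvE /mxtrace mulr_suml; apply: eq_bigr => i _.
    by rewrite -expr2 mulr_sumr.
  have -> : \sum_i \sum_j V 0 i * M j i * V 0 j = dotrv (V *m M^T) V.
    rewrite dotrv_sumE; apply: eq_bigr => j _.
    by apply: eq_bigr => i _; rewrite mxE.
  have -> : \sum_i \sum_j V 0 j * M i j * V 0 i = dotrv (V *m M) V.
    rewrite dotrv_sumE; apply: eq_bigr => i _; apply: eq_bigr => j _; ring.
  rewrite (dotrvC _ V) -dotrv_mull.
  ring.
by lra.
Qed.

End DotProduct.

(* The hypotheses are the data of the Bernstein argument at a critical point of
   [P * G u]: [A] is the Jacobian of [V = Du + sigma X], [S] the Hessian of [u],
   [N] the third derivatives of [u] contracted with [V], [gam = (ln G)'].  They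
   are, in order, the equation, its derivative along [V], the first- and the
   second-order conditions.  Contracting the latter with [P I - V V^T], a
   multiple of the principal part of the equation, eliminates [N]. *)
Lemma critical_point_inequality {R : realFieldType} {m : nat}
    (V D X : 'rV[R]_m) (A S N J : 'M[R]_m) (eps sigma P W h dh gam K : R) :
  J^T = - J -> S^T = S -> A = S + sigma *: J -> V = D + sigma *: X ->
  0 < P -> P = eps ^+ 2 + dotrv V V ->
  0 <= K -> 0 <= gam ->
  P * \tr A - dotrv V (V *m A) = h * (W * P) ->
  2 * dotrv (V *m A) V * \tr A + P * \tr N - dotrv (V *m A^T) (V *m A)
    - (dotrv (V *m A^T) (V *m A^T) + dotrv (V *m N) V)
    = dh * (W * P) + h * (3 * W * dotrv (V *m A) V) ->
  (forall v, 2 * dotrv (V *m A) v + P * gam * dotrv D v = 0) ->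
  (forall v, 2 * (dotrv (v *m A^T) (v *m A^T) + dotrv (v *m N) v)
     + 4 * gam * dotrv (V *m A) v * dotrv D v
     + P * (gam ^+ 2 + K * gam) * dotrv D v ^+ 2
     + P * gam * dotrv (v *m S) v <= 0) ->
  2 * W * dh + gam * h * W * (eps ^+ 2 + sigma * dotrv V X)
    - 2 * gam * sigma ^+ 2 * dotrv (V *m J) X
    + K * gam * eps ^+ 2 * dotrv D D <= 0.
Proof.
move=> skJ syS AE VE P_gt0 PE K0 gam0 eqn deqn crit hess.
have trJ : \tr J = 0 by have := mxtrace_tr J; rewrite skJ raddfN /=; lra.
have trS : \tr S = \tr A by rewrite AE mxtraceD mxtraceZ trJ mulr0 addr0.
set r := V *m A in eqn deqn crit hess *.
(* The first-order condition holds in every direction, so it forces [r] to be parallel to [D]. *)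
have rE : r = - (P * gam / 2) *: D.
  apply/rowP => i; have := crit (delta_mx 0 i).
  by rewrite !dotrv_delta !mxE; lra.
have ATE : V *m A^T = r - (2 * sigma) *: (V *m J).
  rewrite /r AE linearD linearZ /= syS skJ !mulmxDr scalerN mulmxN -!scalemxAr.
  rewrite -addrA -scaleNr -scalerBl; congr (_ + _); rewrite -scaleNr.
  by congr (_ *: _); rewrite -[_ *: sigma]/(_ * _); ring.
have VJV : dotrv (V *m J) V = 0 by exact: dotrv_skew.
have VJD : dotrv (V *m J) D = - sigma * dotrv (V *m J) X.
  by have := VJV; rewrite {2}VE dotrvDr dotrvZr; lra.
have VSV : dotrv (V *m S) V = dotrv r V.
  by rewrite /r AE mulmxDr -scalemxAr dotrvDl dotrvZl VJV mulr0 addr0.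
(* Once [r] is replaced by its multiple of [D], the mixed term becomes [- 2 * P * gam ^+ 2] times
   the square of [dotrv D v]. So [c] is the total coefficient of [D^T *m D], and [M] is the matrix
   of the second-order condition. *)
pose c := P * (K * gam - gam ^+ 2).
pose M := 2 *: (A^T *m A + N) + c *: (D^T *m D) + (P * gam) *: S.
have formM v : dotrv (v *m M) v <= 0.
  apply: le_trans (hess v); rewrite le_eqVlt; apply/orP; left; apply/eqP.
  rewrite /M !mulmxDr -!scalemxAr !(dotrvDl, dotrvZl) dotrv_dyad.
  rewrite mulmxDr dotrvDl mulmxA (dotrv_mull (v *m A^T) v).
  have := crit v; rewrite -/r => cv.
  have -> : 4 * gam * dotrv r v = - (2 * gam ^+ 2 * P * dotrv D v).
    have -> : dotrv r v = - (P * gam * dotrv D v) / 2 by lra.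
    by field.
  by rewrite /c; ring.
have trM : \tr M <= 0.
  by apply: sumr_le0 => i _; rewrite -dotrv_delta_mul; exact: formM.
(* [P] exceeds [dotrv V V] by [eps ^+ 2], and the extra [eps ^+ 2 * \tr M] is nonpositive. *)
have bM : P * \tr M <= dotrv (V *m M) V.
  have := nonpos_form_trace V formM; rewrite PE mulrDl.
  by have := mulr_ge0_le0 (sqr_ge0 eps) trM; lra.
have q_ge0 : 0 <= \tr (A^T *m A).
  apply: sumr_ge0 => i _; rewrite mxE; apply: sumr_ge0 => j _.
  by rewrite mxE -expr2 sqr_ge0.
have rV : dotrv r V = - (P * gam / 2) * dotrv D V by rewrite rE dotrvZl.
have rr : dotrv r r = (P * gam / 2) ^+ 2 * dotrv D D.
  by rewrite rE dotrvZl dotrvZr; ring.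
have ATr : dotrv (V *m A^T) r = dotrv r r - P * gam * sigma ^+ 2 * dotrv (V *m J) X.
  by rewrite {1}ATE dotrvDl dotrvNl dotrvZl {3}rE dotrvZr VJD; field.
(* Ellipticity of [P I - V V^T] in the direction [D]: this yields the good term
   [K * gam * eps ^+ 2 * dotrv D D]. *)
have Pd : eps ^+ 2 * dotrv D D <= P * dotrv D D - dotrv D V ^+ 2.
  by have := Cauchy_Schwarz_dotrv D V; rewrite PE; lra.
(* Twice this bound and twice the [dotrv r r] from [ATr] add up to [P ^+ 2 * gam ^+ 2 * dotrv D D],
   which cancels the negative part of [c] there. *)
have Pq : dotrv r r <= P * \tr (A^T *m A).
  have := sumr_sqr_dotrv V A; have := mulr_ge0 (sqr_ge0 eps) q_ge0.
  by rewrite -/r PE; lra.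
have VVE : dotrv V V = dotrv D V + sigma * dotrv V X.
  by rewrite {1}VE dotrvDl dotrvZl (dotrvC X).
move: bM.
rewrite /M !mulmxDr -!scalemxAr !(dotrvDl, dotrvZl) dotrv_dyad VSV mulmxDr dotrvDl.
rewrite mulmxA (dotrv_mull (V *m A^T) V) !mxtraceD !mxtraceZ mxtraceD mxtrace_dyad trS.
move: deqn eqn Pq; rewrite ATr (dotrvC V r) rr rV.
move: PE Pd; rewrite VVE.
move: (dotrv D D) (dotrv D V) (dotrv V X) (dotrv (V *m J) X) (\tr A) (\tr N)
  (\tr (A^T *m A)) (dotrv (V *m A^T) _) (dotrv (V *m N) V).
move=> d dv vx jx t n q s1 s2 PE Pd deqn eqn Pq bM.
(* The equation eliminates [\tr A]; the resulting [dv ^+ 2] term cancels the other half of the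
   [gam ^+ 2] part of [c]. *)
have rVt : - (P * gam / 2) * dv * t =
    P * gam ^+ 2 / 4 * dv ^+ 2 - gam / 2 * dv * (h * (W * P)).
  by rewrite -eqn; field.
have Kgam := ler_wpM2l (mulr_ge0 K0 gam0) Pd.
rewrite -(pmulr_rle0 _ P_gt0).
have KgamP := ler_wpM2l (ltW P_gt0) Kgam.
have gamE := congr1 (fun z => P * gam * z) eqn.
(* All terms with [gam * h] collect into the factor [P - dv], in which [dotrv D D] does not
   appear. *)
have hWE : gam * P * h * W * (P - dv) = gam * P * h * W * (eps ^+ 2 + sigma * vx).
  by rewrite PE; ring.
have deqn2 : 2 * (- (P * gam / 2) * dv * t) + P * n -
  ((P * gam / 2) ^+ 2 * d - P * gam * sigma ^+ 2 * jx) - (s1 + s2) =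
  dh * (W * P) + h * (3 * W * (- (P * gam / 2) * dv)).
  by rewrite -deqn; ring.
rewrite rVt in deqn2.
rewrite /c in bM.
lra.
Qed.

(** * Directional derivatives: second-derivative test and symmetry of mixed derivatives *)

Section DirectionalDerivatives.
Context {R : realType} {U : normedModType R}.
Implicit Types (f g F G : U -> R) (x z v w : U).

(** The difference quotients coincide; this transfers the one-variable chain rule and mean value
    theorem to [U]. *)
Lemma is_derive_lineP f z v (t d : R) :
  is_derive (t *: v + z) v f d <->
  is_derive t 1 (fun s : R => f (s *: v + z)) d.
Proof.
have eqf : (fun h : R => h^-1 *: ((f \o shift (t *: v + z)) (h *: v) - f (t *: v + z)))
  = (fun h : R => h^-1 *: (((fun s : R => f (s *: v + z)) \o shift t) (h *: 1)
      - f (t *: v + z))).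
  by apply/funext => h /=; rewrite addrA -scalerDl [h *: 1]mulr1.
by split=> -[dv d_eq]; apply: DeriveDef; move: dv d_eq;
  rewrite /derivable /derive eqf.
Qed.

Lemma is_derive_chain (phi : R -> R) f z v (a b : R) :
  is_derive (f z) 1 phi a -> is_derive z v f b ->
  is_derive z v (fun y => phi (f y)) (a * b).
Proof.
move=> dphi df; rewrite -[z]add0r -[X in X + _](scale0r v).
apply/is_derive_lineP.
apply: (@is_derive1_comp _ phi (fun s : R => f (s *: v + z))).
  by rewrite scale0r add0r.
by apply/is_derive_lineP; rewrite scale0r add0r.
Qed.

(** If [d > 0], then [g > 0] just to the right of [0], and the mean value theorem gives [f t > f 0]
    for small [t > 0]. *)
Lemma second_derivative_test_line (f g : R -> R) (d : R) :
  (\forall t \near (0 : R), is_derive t (1 : R) f (g t)) -> is_derive (0 : R) (1 : R) g d ->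
  (\forall t \near (0 : R), f t <= f 0) -> g 0 = 0 /\ d <= 0.
Proof.
move=> df dg fmax.
have [e e_gt0 He] : exists2 e : R, 0 < e &
    forall t : R, `|t| < e -> is_derive t (1 : R) f (g t) /\ f t <= f 0.
  have /nbhs_ballP[e /= e0 He] : \forall t \near (0 : R), is_derive t (1 : R) f (g t) /\ f t <= f 0.
    by near=> t; split; near: t.
  by exists e => // t te; apply: He; rewrite /ball /= sub0r normrN.
have in_e t : t \in `](- e), e[%R -> `|t| < e.
  by rewrite in_itv /= ltr_norml.
have g0 : g 0 = 0.
  have d0 : is_derive (0 : R) (1 : R) f 0.
    apply: (@derive1_at_max _ f (- e) e).
    - by lra.
    - by move=> t /in_e /He[[]].
    - by rewrite in_itv /= oppr_lt0 e_gt0.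
    - by move=> t /in_e /He[].
  have ze : `|0 : R| < e by rewrite normr0.
  by have [[_ <-] _] := He 0 ze; case: d0.
split=> //; rewrite leNgt; apply/negP => d_gt0.
have : (fun h : R => h^-1 *: ((g \o shift 0) (h *: 1) - g 0)) @ 0^' --> d.
  by case: dg => dg <-; exact: dg.
move=> /(_ [set y : R | 0 < y]) /=.
have d_nbhs : nbhs d [set y : R | 0 < y] by apply: lt_nbhsr.
move=> /(_ d_nbhs); rewrite !near_simpl => /nbhs_ballP[e' /= e'0 He'].
pose t := Num.min e e' / 2.
have m0 : 0 < Num.min e e' by rewrite lt_min e_gt0.
have t0 : 0 < t by rewrite divr_gt0.
have tm : t < Num.min e e' by rewrite /t; lra.
have /andP[te te'] : (t < e) && (t < e') by rewrite -lt_min.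
have dft s : s \in `[0, t]%R -> is_derive s (1 : R) f (g s).
  rewrite in_itv /= => /andP[s0 st].
  by apply: (He s _).1; rewrite ger0_norm //; apply: le_lt_trans te.
have [c] := @MVT R f g 0 t t0 (fun s sI => dft s (subset_itv_oo_cc sI))
  (derivable_within_continuous (fun s sI => @ex_derive _ _ _ _ _ _ _ (dft s sI))).
rewrite in_itv /= => /andP[c0 ct] fE.
have /= := He' c; rewrite /ball /= sub0r normrN gtr0_norm // (lt_trans ct) //.
rewrite addr0 g0 subr0 [c *: 1]mulr1 => /(_ isT) gc.
have {}gc : 0 < g c by move: (gc (lt0r_neq0 c0)); rewrite /GRing.scale /= pmulr_rgt0 // invr_gt0.
have te0 : `|t| < e by rewrite gtr0_norm.
by have [_] := He t te0; have := mulr_gt0 gc t0; lra.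
Unshelve. all: by end_near. Qed.

Lemma second_derivative_test F G z v (d : R) :
  (\forall y \near z, is_derive y v F (G y)) -> is_derive z v G d ->
  (\forall y \near z, F y <= F z) -> G z = 0 /\ d <= 0.
Proof.
move=> dF dG maxF.
have line_cvg : (fun t : R => t *: v + z) @ 0 --> z.
  rewrite -[X in _ --> X]add0r -[X in X + _](scale0r v).
  apply: cvgD; last exact: cvg_cst.
  by apply: cvgZr_tmp; exact: cvg_id.
have := @second_derivative_test_line (fun t : R => F (t *: v + z))
  (fun t : R => G (t *: v + z)) d.
rewrite !scale0r !add0r; apply.
- have dFl : \forall t \near (0 : R), is_derive (t *: v + z) v F (G (t *: v + z)).
    exact: line_cvg dF.
  by near=> t; apply/is_derive_lineP; near: t.
- by apply/is_derive_lineP; rewrite scale0r add0r.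
- exact: (line_cvg _ maxF).
Unshelve. all: by end_near. Qed.

(** Room for the mean value theorem along both directions; with [w = 0] it is a segment issuing from
    [z]. *)
Lemma nbhs_parallelogram z v w (A : set U) : nbhs z A ->
  exists2 t : R, 0 < t & forall a b, a \in `[0, t]%R -> b \in `[0, t]%R ->
    A (a *: v + (b *: w + z)).
Proof.
move=> /nbhs_normP[e /= e0 He].
pose t := e / (`|v| + `|w| + 1).
have n0 : 0 < `|v| + `|w| + 1 by rewrite ltr_wpDl // addr_ge0.
exists (t / 2); first by rewrite !divr_gt0.
move=> a b; rewrite !in_itv /= => /andP[a0 at_] /andP[b0 bt]; apply: He => /=.
rewrite distrC addrA addrK (le_lt_trans (ler_normD _ _)) // !normrZ !ger0_norm //.
have te : t * (`|v| + `|w| + 1) = e by rewrite /t divfK // gt_eqF.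
have t0 : 0 < t by rewrite divr_gt0.
have v0 := normr_ge0 v; have w0 := normr_ge0 w.
have := ler_wpM2r v0 at_; have := ler_wpM2r w0 bt.
have := mulr_ge0 (ltW t0) v0; have := mulr_ge0 (ltW t0) w0.
by lra.
Qed.

(** The mean value theorem along [v], applied to the increment of [f] along [w], and then along [w],
    applied to [fv]. *)
Lemma second_difference f fv fvw z v w (t : R) : 0 < t ->
  (forall a b, a \in `[0, t]%R -> b \in `[0, t]%R ->
    is_derive (a *: v + (b *: w + z)) v f (fv (a *: v + (b *: w + z))) /\
    is_derive (a *: v + (b *: w + z)) w fv (fvw (a *: v + (b *: w + z)))) ->
  exists a b, [/\ a \in `[0, t]%R, b \in `[0, t]%R &
    f (t *: v + (t *: w + z)) - f (t *: w + z) - f (t *: v + z) + f z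
    = fvw (a *: v + (b *: w + z)) * t ^+ 2].
Proof.
move=> t0 df.
have t_in : t \in `[0, t]%R by rewrite in_itv /= lexx ltW.
have o_in : 0 \in `[0, t]%R by rewrite in_itv /= lexx ltW.
pose g a := f (a *: v + (t *: w + z)) - f (a *: v + z).
pose g' a := fv (a *: v + (t *: w + z)) - fv (a *: v + z).
have dg a : a \in `[0, t]%R -> is_derive a 1 g (g' a).
  move=> aI; apply: is_deriveB; apply/is_derive_lineP.
    exact: (df a t _ _).1.
  by have := (df a 0 aI o_in).1; rewrite scale0r add0r.
have [a aI gE] := @MVT R g g' 0 t t0 (fun s sI => dg s (subset_itv_oo_cc sI))
  (derivable_within_continuous (fun s sI => @ex_derive _ _ _ _ _ _ _ (dg s sI))).
have {}aI := subset_itv_oo_cc aI.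
have dk b : b \in `[0, t]%R ->
    is_derive b 1 (fun b => fv (b *: w + (a *: v + z))) (fvw (b *: w + (a *: v + z))).
  by move=> bI; apply/is_derive_lineP; rewrite addrCA; exact: (df a b _ _).2.
have [b bI kE] := @MVT R _ (fun b => fvw (b *: w + (a *: v + z))) 0 t t0
  (fun s sI => dk s (subset_itv_oo_cc sI))
  (derivable_within_continuous (fun s sI => @ex_derive _ _ _ _ _ _ _ (dk s sI))).
exists a, b; split=> //; first exact: subset_itv_oo_cc.
move: gE kE; rewrite /g /g' !scale0r !add0r subr0 (addrCA (t *: w)) (addrCA (b *: w)).
move=> gE kE; rewrite kE in gE.
by rewrite expr2 mulrA -gE; ring.
Qed.

(** The second difference is symmetric in [v] and [w], so [fvw] and [fwv] agree at two points of an
    arbitrarily small parallelogram; continuity at [z] concludes. *)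
Lemma mixed_derivatives_eq f fv fw fvw fwv z v w :
  (\forall y \near z, is_derive y v f (fv y) /\ is_derive y w f (fw y)) ->
  (\forall y \near z, is_derive y w fv (fvw y) /\ is_derive y v fw (fwv y)) ->
  {for z, continuous fvw} -> {for z, continuous fwv} -> fvw z = fwv z.
Proof.
move=> d1 d2 c1 c2; apply/eqP; rewrite -subr_eq0 -normr_le0.
apply/ler_addgt0Pr => e e0; rewrite add0r.
have e20 : 0 < e / 2 by rewrite divr_gt0.
have near_all : \forall y \near z,
   [/\ is_derive y v f (fv y) /\ is_derive y w fv (fvw y),
       is_derive y w f (fw y) /\ is_derive y v fw (fwv y),
       `|fvw z - fvw y| < e / 2 & `|fwv z - fwv y| < e / 2].
  near=> y; split.
  - by split; [have [] : is_derive y v f (fv y) /\ is_derive y w f (fw y) by near: y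
      | have [] : is_derive y w fv (fvw y) /\ is_derive y v fw (fwv y) by near: y].
  - by split; [have [] : is_derive y v f (fv y) /\ is_derive y w f (fw y) by near: y
      | have [] : is_derive y w fv (fvw y) /\ is_derive y v fw (fwv y) by near: y].
  - by near: y; move/cvgrPdist_lt: c1; apply.
  - by near: y; move/cvgrPdist_lt: c2; apply.
have [t t0 Ht] := nbhs_parallelogram v w near_all.
have [a [b [aI bI E1]]] := @second_difference f fv fvw z v w t t0
  (fun a b aI bI => let: And4 h _ _ _ := Ht a b aI bI in h).
have H2 a' b' : a' \in `[0, t]%R -> b' \in `[0, t]%R ->
    is_derive (a' *: w + (b' *: v + z)) w f (fw (a' *: w + (b' *: v + z))) /\
    is_derive (a' *: w + (b' *: v + z)) v fw (fwv (a' *: w + (b' *: v + z))).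
  by move=> aI' bI'; rewrite addrCA; case: (Ht b' a' bI' aI').
have [a' [b' [aI' bI' E2]]] := @second_difference f fw fwv z w v t t0 H2.
have eqq : fvw (a *: v + (b *: w + z)) = fwv (b' *: v + (a' *: w + z)).
  rewrite [X in fwv X]addrCA.
  have t2 : t ^+ 2 != 0 by rewrite expf_neq0 // gt_eqF.
  apply: (mulIf t2); rewrite -E1 -E2 (addrCA (t *: w)); ring.
have [_ _ l1 _] := Ht a b aI bI; have [_ _ _ l2] := Ht b' a' bI' aI'.
have -> : fvw z - fwv z = (fvw z - fvw (a *: v + (b *: w + z)))
   - (fwv z - fwv (b' *: v + (a' *: w + z))) by rewrite eqq; ring.
by apply: le_trans (ler_normB _ _) _; lra.
Unshelve. all: by end_near. Qed.

End DirectionalDerivatives.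

(** * Derivative rules for scalar and matrix expressions *)

Section DerivativeRules.
Context {R : realType} {U : normedModType R}.
Implicit Types (f g : U -> R) (z v : U).

Lemma is_deriveDf f g z v (a b : R) : is_derive z v f a -> is_derive z v g b ->
  is_derive z v (fun y => f y + g y) (a + b).
Proof. exact: is_deriveD. Qed.

Lemma is_deriveMf f g z v (a b : R) : is_derive z v f a -> is_derive z v g b ->
  is_derive z v (fun y => f y * g y) (f z * b + g z * a).
Proof. exact: is_deriveM. Qed.

Lemma is_deriveZf f z v (c a : R) : is_derive z v f a ->
  is_derive z v (fun y => c * f y) (c * a).
Proof. exact: is_deriveZ. Qed.

Lemma is_deriveVf f z v (a : R) : f z != 0 -> is_derive z v f a ->
  is_derive z v (fun y => (f y)^-1) (- (f z) ^- 2 * a).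
Proof.
move=> fz0 [df <-]; apply: DeriveDef; first exact: derivableV.
exact: deriveV.
Qed.

Lemma is_deriveBf f g z v (a b : R) : is_derive z v f a -> is_derive z v g b ->
  is_derive z v (fun y => f y - g y) (a - b).
Proof. exact: is_deriveB. Qed.

Lemma is_derive_sumf k (h : 'I_k -> U -> R) z v (dh : 'I_k -> R) :
  (forall i, is_derive z v (h i) (dh i)) ->
  is_derive z v (fun y => \sum_i h i y) (\sum_i dh i).
Proof.
move=> dhi; have := is_derive_sum dhi.
by congr (is_derive _ _ _ _); apply/funext => y; rewrite fct_sumE.
Qed.

Definition is_derive_mx {p q} z v (F : U -> 'M[R]_(p, q)) (dF : 'M[R]_(p, q)) :=
  forall i j, is_derive z v (fun y => F y i j) (dF i j).

Lemma is_derive_mxD p q z v (F G : U -> 'M[R]_(p, q)) dF dG :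
  is_derive_mx z v F dF -> is_derive_mx z v G dG ->
  is_derive_mx z v (fun y => F y + G y) (dF + dG).
Proof.
move=> hF hG i j; rewrite mxE.
rewrite (_ : (fun y => _) = (fun y => F y i j + G y i j)); last first.
  by apply/funext => y; rewrite mxE.
exact: is_deriveDf.
Qed.

Lemma is_derive_mxM p q s z v (F : U -> 'M[R]_(p, q)) (G : U -> 'M[R]_(q, s))
  dF dG : is_derive_mx z v F dF -> is_derive_mx z v G dG ->
  is_derive_mx z v (fun y => F y *m G y) (dF *m G z + F z *m dG).
Proof.
move=> hF hG i j.
rewrite (_ : (fun y => _) = (fun y => \sum_k F y i k * G y k j)); last first.
  by apply/funext => y; rewrite mxE.
rewrite !mxE -big_split /=; apply: is_derive_sumf => k.
apply: is_derive_eq; first exact: is_deriveMf (hF i k) (hG k j).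
by rewrite addrC [G z k j * _]mulrC.
Qed.

Lemma is_derive_mx_tr p q z v (F : U -> 'M[R]_(p, q)) dF :
  is_derive_mx z v F dF -> is_derive_mx z v (fun y => (F y)^T) dF^T.
Proof.
move=> hF i j; rewrite mxE (_ : (fun y => _) = (fun y => F y j i)) //.
by apply/funext => y; rewrite mxE.
Qed.

Lemma is_derive_mxtrace p z v (F : U -> 'M[R]_p) dF :
  is_derive_mx z v F dF -> is_derive z v (fun y => \tr (F y)) (\tr dF).
Proof. by move=> hF; apply: is_derive_sumf => i; exact: hF. Qed.

Lemma is_derive_dotrv p z v (F G : U -> 'rV[R]_p) dF dG :
  is_derive_mx z v F dF -> is_derive_mx z v G dG ->
  is_derive z v (fun y => dotrv (F y) (G y)) (dotrv dF (G z) + dotrv (F z) dG).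
Proof.
move=> hF hG; have := is_derive_mxM hF (is_derive_mx_tr hG).
by move=> /(_ 0 0); rewrite mxE.
Qed.

Lemma is_derive_mx_cst p q z v (M : 'M[R]_(p, q)) : is_derive_mx z v (fun=> M) 0.
Proof. by move=> i j; rewrite mxE; exact: is_derive_cst. Qed.

End DerivativeRules.

(** * Partial derivatives and their symmetries *)

Section PartialDerivatives.
Context {R : realType} {m : nat}.
Implicit Types (f : 'rV[R]_m -> R) (z v : 'rV[R]_m) (Om : set 'rV[R]_m).

Lemma is_derive_pd f i z : differentiable f z ->
  is_derive z (delta_mx 0 i) f (pd f i z).
Proof. by move=> df; apply: derivableP; exact: diff_derivable. Qed.

Lemma is_derive_grad f z v : differentiable f z ->
  is_derive z v f (dotrv v (grad f z)).
Proof.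
move=> df; apply: DeriveDef; first exact: diff_derivable.
rewrite deriveE // {1}(row_sum_delta v) linear_sum dotrvE.
apply: eq_bigr => i _; rewrite linearZ /= mxE /pd deriveE //.
Qed.

Lemma is_derive_linear p (M : 'M[R]_(m, p)) z v :
  is_derive_mx z v (fun y => y *m M) (v *m M).
Proof.
have idv : is_derive_mx z v (fun y : 'rV[R]_m => y) v.
  move=> i j.
  have quot : \forall h \near (0 : R)^',
      h^-1 *: (((fun y : 'rV[R]_m => y i j) \o shift z) (h *: v) - z i j) = v i j.
    near=> h; rewrite /= !mxE addrK.
    have h0 : h != 0 by near: h; exact: nbhs_dnbhs_neq.
    by rewrite -[_ *: _]/(h^-1 * _) mulKf.
  by apply: DeriveDef; [exact: is_cvg_near_cst quot|exact: lim_near_cst].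
have := is_derive_mxM idv (is_derive_mx_cst z v M).
by rewrite mulmx0 addr0.
Unshelve. all: by end_near. Qed.

Lemma Ck_pred k Om f : Ck k.+1 Om f -> Ck k Om f.
Proof.
elim: k f => [|k IH] f /= [df dk].
  apply: continuous_in_subspaceT => z /[!inE] /df.
  exact: differentiable_continuous.
by split=> // i; apply: IH.
Qed.

Lemma pd_comm Om f i j z : open Om -> Ck 2 Om f -> Om z ->
  pd (pd f i) j z = pd (pd f j) i z.
Proof.
move=> oOm [df d2f] Omz.
have nOm : \forall y \near z, Om y by apply: open_nbhs_nbhs.
apply: (@mixed_derivatives_eq _ _ f (pd f i) (pd f j) (pd (pd f i) j)
  (pd (pd f j) i) z (delta_mx 0 i) (delta_mx 0 j)).
- near=> y; have Omy : Om y by near: y.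
  by split; apply: is_derive_pd; exact: df.
- near=> y; have Omy : Om y by near: y.
  by split; apply: is_derive_pd; [exact: (d2f i).1|exact: (d2f j).1].
- have [_ /(_ j)] := d2f i.
  by rewrite continuous_open_subspace //; apply; rewrite inE.
- have [_ /(_ i)] := d2f j.
  by rewrite continuous_open_subspace //; apply; rewrite inE.
Unshelve. all: by end_near. Qed.

Lemma pd_near_eq f g i z : (\forall y \near z, f y = g y) -> pd f i z = pd g i z.
Proof. by move=> fg; apply: near_eq_derive. Qed.

(** These two transpositions generate all permutations of the indices. The second identity is the
    symmetry of the Hessian, valid near [z] and differentiated once more. *)
Lemma third_pd_symm Om f i j k z : open Om -> Ck 3 Om f -> Om z ->
  pd (pd (pd f i) j) k z = pd (pd (pd f i) k) j z /\
  pd (pd (pd f i) j) k z = pd (pd (pd f j) i) k z.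
Proof.
move=> oOm C3 Omz; split; first exact: (pd_comm _ _ oOm (C3.2 i) Omz).
apply: pd_near_eq; have nOm : \forall y \near z, Om y by apply: open_nbhs_nbhs.
near=> y; apply: (@pd_comm Om) => //; first exact: Ck_pred.
by near: y.
Unshelve. all: by end_near. Qed.

End PartialDerivatives.

(** * The field X as a skew linear map *)

Section RotationField.
Context {R : realType} {n : nat}.

(** The Jacobian of X, with entry [(k, i)] the [i]-th derivative of the [k]-th component; hence the
    transpose in [XfE], where it acts on a row vector. *)
Definition rot_mx : 'M[R]_(n + n) := block_mx 0 (- 1%:M) 1%:M 0.

Lemma rot_mx_skew : rot_mx^T = - rot_mx.
Proof.
by rewrite /rot_mx tr_block_mx opp_block_mx !trmx0 !oppr0 opprK linearN /= trmx1.
Qed.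

Lemma XfE (z : 'rV[R]_(n + n)) : Xf z = z *m rot_mx^T.
Proof.
rewrite rot_mx_skew /rot_mx opp_block_mx !oppr0 opprK.
rewrite -[in RHS](hsubmxK z) mul_row_block !mulmx0 mulmx1 add0r addr0.
by rewrite mulmxN mulmx1.
Qed.

Lemma esqE k (v : 'rV[R]_k) : esq v = dotrv v v.
Proof. by rewrite dotrvE; apply: eq_bigr => i _; rewrite expr2. Qed.

End RotationField.

(** * The differential inequality at an interior maximum *)

Section InteriorMaximum.
Context {R : realType} {n : nat}.
Context (Om : set 'rV[R]_(n + n)) (u H : 'rV[R]_(n + n) -> R) (eps sigma : R).
Context (oOm : open Om) (eps_neq0 : eps != 0).
Context (C3u : Ck 3 Om u) (C1H : Ck 1 Om H).
Context (eqn : forall z, Om z ->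
  divg (fun w => (Num.sqrt (eps ^+ 2 + esq (grad u w + sigma *: Xf w)))^-1
                   *: (grad u w + sigma *: Xf w)) z = sigma * H z).
Implicit Types (z v : 'rV[R]_(n + n)).

(* [A] is the Jacobian of [V], and [T z v] the derivative of [S] and of [A]
   along [v]. *)
Local Notation J := (@rot_mx R n).
Let V z := grad u z + sigma *: Xf z.
Let S z : 'M[R]_(n + n) := \matrix_(k, i) pd (pd u k) i z.
Let A z := S z + sigma *: J.
Let T z v : 'M[R]_(n + n) := \matrix_(k, i) dotrv v (grad (pd (pd u k) i) z).
Let P z := eps ^+ 2 + dotrv (V z) (V z).
Let W z := Num.sqrt (P z).

Let P_gt0 z : 0 < P z.
Proof. by rewrite ltr_wpDr ?dotrv_ge0 // exprn_even_gt0. Qed.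

Let W_gt0 z : 0 < W z.
Proof. by rewrite sqrtr_gt0. Qed.

Let WW z : W z * W z = P z.
Proof. by rewrite -expr2 sqr_sqrtr // ltW. Qed.

Let S_sym z : Om z -> (S z)^T = S z.
Proof.
move=> Omz; apply/matrixP => i j; rewrite !mxE.
by apply: (pd_comm _ _ oOm _ Omz); exact: Ck_pred.
Qed.

Let d_u z v : Om z -> is_derive z v u (dotrv v (grad u z)).
Proof. by move=> Omz; apply: is_derive_grad; exact: C3u.1. Qed.

Let d_grad z v : Om z -> is_derive_mx z v (grad u) (v *m (S z)^T).
Proof.
move=> Omz i j; rewrite ord1.
rewrite (_ : (fun y => _) = pd u j); last by apply/funext => y; rewrite mxE.
apply: is_derive_eq; first by apply: is_derive_grad; exact: (C3u.2 j).1.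
by rewrite dotrvE mxE; apply: eq_bigr => k _; rewrite !mxE.
Qed.

Let d_S z v : Om z -> is_derive_mx z v S (T z v).
Proof.
move=> Omz i j; rewrite mxE.
rewrite (_ : (fun y => _) = pd (pd u i) j); last by apply/funext => y; rewrite mxE.
by apply: is_derive_grad; exact: ((C3u.2 i).2 j).1.
Qed.

Let d_A z v : Om z -> is_derive_mx z v A (T z v).
Proof.
move=> Omz; rewrite -[T z v]addr0.
exact: is_derive_mxD (d_S _ Omz) (is_derive_mx_cst _ _ _).
Qed.

Let d_V z v : Om z -> is_derive_mx z v V (v *m (A z)^T).
Proof.
move=> Omz; rewrite /A linearD linearZ /= mulmxDr -scalemxAr.
have dX := is_derive_linear (sigma *: J^T) z v.
rewrite (_ : V = fun y => grad u y + y *m (sigma *: J^T)); last first.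
  by apply/funext => y; rewrite /V XfE -scalemxAr.
by rewrite scalemxAr; apply: is_derive_mxD dX; exact: d_grad.
Qed.

Let d_P z v : Om z -> is_derive z v P (2 * dotrv (V z *m A z) v).
Proof.
move=> Omz; have dd := is_derive_dotrv (d_V v Omz) (d_V v Omz).
have := is_deriveDf (is_derive_cst (eps ^+ 2) z v) dd.
move=> /is_derive_eq; apply.
by rewrite add0r (dotrv_mull (V z)) (dotrvC (_ *m _)); ring.
Qed.

Let d_W z v : Om z -> is_derive z v W (dotrv (V z *m A z) v / W z).
Proof.
move=> Omz; apply: is_derive_eq.
  exact: is_derive_chain (is_derive1_sqrt (P_gt0 z)) (d_P v Omz).
by rewrite -/(W z); have := W_gt0 z; move=> w0; field; rewrite gt_eqF.
Qed.

(** Expanding the divergence gives [\tr A / W] minus [dotrv V (V *m A) / W ^+ 3]; multiplying by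
    [W ^+ 3 = W * P] clears the denominators before the next differentiation. *)
Let expanded_eqn z : Om z ->
  P z * \tr (A z) - dotrv (V z) (V z *m A z) = sigma * H z * (W z * P z).
Proof.
move=> Omz; rewrite -(eqn Omz).
have W0 : W z != 0 by rewrite gt_eqF.
have dF i : pd (fun w => ((Num.sqrt (eps ^+ 2 + esq (grad u w + sigma *: Xf w)))^-1
      *: (grad u w + sigma *: Xf w)) 0 i) i z =
    (W z)^-1 * A z i i - V z 0 i * (V z *m A z) 0 i / (W z ^+ 3).
  rewrite (_ : (fun w => _) = fun w => (W w)^-1 * V w 0 i); last first.
    by apply/funext => w; rewrite mxE /W /P esqE.
  have dW := is_deriveVf W0 (d_W (delta_mx 0 i) Omz).
  have [_] := is_deriveMf dW (d_V (delta_mx 0 i) Omz 0 i).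
  rewrite /pd => ->; rewrite -rowE !mxE.
  rewrite dotrv_delta.
  by rewrite mxE; field.
rewrite /divg (eq_bigr _ (fun i _ => dF i)) sumrB -mulr_sumr -mulr_suml -dotrvE.
rewrite -/(\tr (A z)) -WW; move: W0; move: (W z) (\tr _) (dotrv _ _) => w t d w0.
by field.
Qed.

Let differentiated_eqn z : Om z ->
  2 * dotrv (V z *m A z) (V z) * \tr (A z) + P z * \tr (T z (V z))
    - dotrv (V z *m (A z)^T) (V z *m A z)
    - (dotrv (V z *m (A z)^T) (V z *m (A z)^T) + dotrv (V z *m T z (V z)) (V z))
  = sigma * dotrv (V z) (grad H z) * (W z * P z)
    + sigma * H z * (3 * W z * dotrv (V z *m A z) (V z)).
Proof.
move=> Omz.
have dL := is_deriveBf (is_deriveMf (d_P (V z) Omz) (is_derive_mxtrace (d_A (V z) Omz)))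
  (is_derive_dotrv (d_V (V z) Omz) (is_derive_mxM (d_V (V z) Omz) (d_A (V z) Omz))).
have dH : is_derive z (V z) H (dotrv (V z) (grad H z)).
  by apply: is_derive_grad; exact: C1H.1.
have dR := is_deriveMf (is_deriveZf sigma dH)
  (is_deriveMf (d_W (V z) Omz) (d_P (V z) Omz)).
have nOm : \forall y \near z, Om y by apply: open_nbhs_nbhs.
have eqLR : \forall y \near z, P y * \tr (A y) - dotrv (V y) (V y *m A y)
    = sigma * H y * (W y * P y).
  by near=> y; apply: expanded_eqn; near: y.
have [_ eL] := near_eq_is_derive eqLR dL.
have [_ eR] := dR.
have := etrans (esym eL) eR; rewrite (dotrvDr (V z) (_ *m _)).
rewrite (dotrvC (V z) (_ *m A z)) (dotrv_mull (V z *m (A z)^T)).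
rewrite (dotrvC (V z) (V z *m T z _)) => E.
(* With this, the derivative of [W * P] along [V] becomes [(2 + 1) * W * dotrv (V *m A) V]. *)
have PW : P z * (dotrv (V z *m A z) (V z) / W z) = W z * dotrv (V z *m A z) (V z).
  rewrite -WW; have := W_gt0 z; move: (W z) (dotrv _ _) => w r w0.
  by field; rewrite gt_eqF.
rewrite PW in E.
by lra.
Unshelve. all: by end_near. Qed.

(** The second-order condition produces the left side, while the differentiated equation contains
    [T z (V z)]; full symmetry of the third derivatives identifies the two forms. *)
Let third_form_sym z v : Om z ->
  dotrv (V z *m T z v) v = dotrv (v *m T z (V z)) v.
Proof.
move=> Omz; rewrite !dotrv_sumE.
pose t i j k := pd (pd (pd u i) j) k z.
have TE w i j : T z w i j = \sum_k w 0 k * t i j k.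
  by rewrite mxE dotrvE; apply: eq_bigr => k _; rewrite mxE.
under eq_bigr => k _ do under eq_bigr => i _ do rewrite TE mulr_sumr mulr_suml.
under [in RHS]eq_bigr => k _ do under eq_bigr => i _ do
  rewrite TE mulr_sumr mulr_suml.
transitivity (\sum_i \sum_j \sum_k
   V z 0 k * (v 0 j * t k i j) * v 0 i).
  rewrite exchange_big /=.
  apply: eq_bigr => i _.
  exact: exchange_big.
apply: eq_bigr => i _; apply: eq_bigr => j _; apply: eq_bigr => k _.
have [tE _] := third_pd_symm i j k oOm C3u Omz.
have [_ tE'] := third_pd_symm i k j oOm C3u Omz.
rewrite [t i j k]tE -/(t i k j) [t i k j]tE' -/(t k i j).
ring.
Qed.

(* [gam = (ln G)'] and [gam' = K gam], so that [ln G] is convex, with a second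
   derivative that dominates the first one for large [K]. *)
Lemma bernstein_inequality (G gam : R -> R) (K : R) z :
  (forall s : R, is_derive s (1 : R) G (gam s * G s)) ->
  (forall s : R, is_derive s (1 : R) gam (K * gam s)) ->
  (forall s, 0 < G s) -> (forall s, 0 <= gam s) -> 0 <= K -> Om z ->
  (\forall y \near z, P y * G (u y) <= P z * G (u z)) ->
  2 * W z * (sigma * dotrv (V z) (grad H z))
    + gam (u z) * (sigma * H z) * W z * (eps ^+ 2 + sigma * dotrv (V z) (Xf z))
    - 2 * gam (u z) * sigma ^+ 2 * dotrv (V z *m J) (Xf z)
    + K * gam (u z) * eps ^+ 2 * dotrv (grad u z) (grad u z) <= 0.
Proof.
move=> dG dgam G_gt0 gam_ge0 K_ge0 Omz maxz.
have nOm : \forall y \near z, Om y by apply: open_nbhs_nbhs.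
pose Psi y := P y * G (u y).
(* The factor [G (u y)] stands in front because the bracket vanishes at [z]: differentiating [G]
   then contributes nothing to the second derivative. *)
pose dPsi v y := G (u y) * (2 * dotrv (V y *m A y) v
   + P y * (gam (u y) * dotrv v (grad u y))).
have d_Psi v : \forall y \near z, is_derive y v Psi (dPsi v y).
  near=> y; have Omy : Om y by near: y.
  apply: is_derive_eq.
    exact: is_deriveMf (d_P v Omy) (is_derive_chain (dG (u y)) (d_u v Omy)).
  by rewrite /dPsi; ring.
have test v : 2 * dotrv (V z *m A z) v + P z * gam (u z) * dotrv (grad u z) v = 0 /\
   2 * (dotrv (v *m (A z)^T) (v *m (A z)^T) + dotrv (v *m T z (V z)) v)
   + 2 * gam (u z) * dotrv (V z *m A z) v * dotrv (grad u z) v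
   + P z * (K * gam (u z)) * dotrv (grad u z) v ^+ 2
   + P z * gam (u z) * dotrv (v *m S z) v <= 0.
  have cst_v : is_derive_mx z v (fun=> v) 0 by exact: is_derive_mx_cst.
  have d1 := is_derive_dotrv (is_derive_mxM (d_V v Omz) (d_A v Omz)) cst_v.
  have d2 := is_derive_dotrv cst_v (d_grad v Omz).
  have d3 := is_deriveMf (d_P v Omz)
    (is_deriveMf (is_derive_chain (dgam (u z)) (d_u v Omz)) d2).
  have d4 := is_deriveMf (is_derive_chain (dG (u z)) (d_u v Omz))
    (is_deriveDf (is_deriveZf 2 d1) d3).
  have [crit hess] := second_derivative_test (d_Psi v) d4 maxz.
  have {}crit : 2 * dotrv (V z *m A z) v + P z * gam (u z) * dotrv (grad u z) v = 0.
    apply: (mulfI (lt0r_neq0 (G_gt0 (u z)))); rewrite mulr0 -[RHS]crit /dPsi.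
    by rewrite (dotrvC v); ring.
  split=> //; rewrite -(pmulr_rle0 _ (G_gt0 (u z))).
  have d0l w : dotrv 0 w = 0 :> R by rewrite /dotrv mul0mx mxE.
  have d0r w : dotrv w 0 = 0 :> R by rewrite dotrvC d0l.
  move: hess; rewrite d0l d0r add0r addr0 dotrvDl (dotrv_mull (v *m (A z)^T)).
  rewrite third_form_sym // (S_sym Omz) (dotrvC v (grad u z)) (dotrvC v (v *m S z)).
  rewrite [P z * (gam (u z) * _)]mulrA crit mul0r addr0.
  by apply: le_trans; rewrite le_eqVlt; apply/orP; left; apply/eqP; ring.
apply: (critical_point_inequality (A := A z) (S := S z) (N := T z (V z)) (P := P z)).
- exact: rot_mx_skew.
- exact: S_sym.
- by [].
- by [].
- exact: P_gt0.
- by [].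
- exact: K_ge0.
- exact: gam_ge0.
- exact: expanded_eqn.
- exact: differentiated_eqn.
- by move=> v; have [] := test v.
- move=> v; have [crit] := test v; apply: le_trans.
  (* The two second-order expressions differ by [gam * dotrv D v] times the first-order condition,
     hence by zero. *)
  have := congr1 (fun x => x * (gam (u z) * dotrv (grad u z) v)) crit.
  by rewrite mul0r; lra.
Unshelve. all: by end_near. Qed.

End InteriorMaximum.

(** * The Euclidean norm *)

Section EuclideanNorm.
Context {R : realType} {m : nat}.
Implicit Types (v w : 'rV[R]_m).

Lemma enormE v : enorm v = Num.sqrt (dotrv v v).
Proof. by rewrite /enorm esqE. Qed.

Lemma enorm_ge0 v : 0 <= enorm v.
Proof. exact: sqrtr_ge0. Qed.

Lemma enorm_sqr v : enorm v ^+ 2 = dotrv v v.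
Proof. by rewrite enormE sqr_sqrtr // dotrv_ge0. Qed.

Lemma dotrv_le_enorm v w : `|dotrv v w| <= enorm v * enorm w.
Proof.
rewrite -(@ler_pXn2r _ 2) ?nnegrE ?mulr_ge0 ?enorm_ge0 //.
by rewrite exprMn !enorm_sqr real_normK ?num_real // Cauchy_Schwarz_dotrv.
Qed.

Lemma enormD v w : enorm (v + w) <= enorm v + enorm w.
Proof.
rewrite -(@ler_pXn2r _ 2) ?nnegrE ?addr_ge0 ?enorm_ge0 //.
rewrite sqrrD !enorm_sqr dotrvDl !dotrvDr (dotrvC w v).
by have := ler_norm (dotrv v w); have := dotrv_le_enorm v w; lra.
Qed.

Lemma enormZ (c : R) v : enorm (c *: v) = `|c| * enorm v.
Proof.
rewrite !enormE dotrvZl dotrvZr mulrA -expr2 sqrtrM ?sqr_ge0 //.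
by rewrite sqrtr_sqr.
Qed.

End EuclideanNorm.

(** * Closures, boundaries and continuity *)

Section Closure.
Context {R : realType}.

(** If [f x > c], the same holds at all points of the closure near [x], and some of these lie in
    [A]. *)
Lemma closure_le {T : topologicalType} (A : set T) (f : T -> R) (c : R) :
  {within closure A, continuous f} -> (forall x, A x -> f x <= c) ->
  forall x, closure A x -> f x <= c.
Proof.
move=> /subspace_continuousP fc Ac x clx; rewrite leNgt; apply/negP => cfx.
have : nbhs (f x) [set y | c < y] by exact: lt_nbhsr.
move=> /(fc x clx) /=; rewrite /fmap /within /= => near_gt.
have [y [Ay /=]] := clx _ near_gt.
by move=> /(_ (subset_closure Ay)); rewrite ltNge Ac.
Qed.

Lemma bounded_closure m (A : set 'rV[R]_m) : bounded_set A -> bounded_set (closure A).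
Proof.
move=> [M [Mreal boundM]]; exists M; split=> // k Mk.
apply: closure_le; last exact: boundM.
by apply: continuous_subspaceT => y; exact: norm_continuous.
Qed.

(** Otherwise [A] is compact, and a coordinate attains its maximum on [A]; openness allows a step
    that increases it. *)
Lemma boundary_nonempty m (A : set 'rV[R]_m) : (0 < m)%N -> A !=set0 -> open A ->
  bounded_set A -> (closure A `\` A) !=set0.
Proof.
move=> m0 [a Aa] oA bA; apply: contrapT => noB.
have clA x : closure A x -> A x.
  by move=> clx; apply: contrapT => nAx; apply: noB; exists x.
pose i := Ordinal m0.
have cA : compact (closure A).
  by apply: bounded_closed_compact; [exact: bounded_closure|exact: closed_closure].
have [||c] := @compact_EVT_max _ R (fun y : 'rV[R]_m => y 0 i) _ _ cA.
- by exists a; exact: subset_closure.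
- by apply: continuous_subspaceT => y; exact: coord_continuous.
rewrite inE => /clA Ac cmax.
have [t t0 /(_ t 0)] := nbhs_parallelogram (delta_mx 0 i) 0 (open_nbhs_nbhs (conj oA Ac)).
rewrite !in_itv /= !lexx (ltW t0) scale0r add0r => /(_ isT isT) Act.
have := cmax (t *: delta_mx 0 i + c).
rewrite inE => /(_ (subset_closure Act)); rewrite !mxE !eqxx mulr1; lra.
Qed.

Lemma cvg_coord {T : Type} {F : set_system T} {FF : Filter F} m
    (f : T -> 'rV[R]_m) (a : 'rV[R]_m) i :
  f @ F --> a -> (fun t => f t 0 i) @ F --> a 0 i.
Proof. by move=> fa; exact: (cvg_comp _ _ fa (@coord_continuous _ _ _ 0 i a)). Qed.

Lemma cvg_dotrv {T : Type} {F : set_system T} {FF : Filter F} m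
    (f g : T -> 'rV[R]_m) (a b : 'rV[R]_m) :
  (forall i, (fun t => f t 0 i) @ F --> a 0 i) ->
  (forall i, (fun t => g t 0 i) @ F --> b 0 i) ->
  (fun t => dotrv (f t) (g t)) @ F --> dotrv a b.
Proof.
move=> fa gb; rewrite dotrvE.
rewrite (_ : (fun t => _) = fun t => \sum_i f t 0 i * g t 0 i); last first.
  by apply/funext => t; rewrite dotrvE.
by apply: cvg_big => [|i _]; [exact: add_continuous|exact: cvgM].
Qed.

Lemma cvg_mulmx_coord {T : Type} {F : set_system T} {FF : Filter F} m p
    (f : T -> 'rV[R]_m) (a : 'rV[R]_m) (M : 'M[R]_(m, p)) j :
  f @ F --> a -> (fun t => (f t *m M) 0 j) @ F --> (a *m M) 0 j.
Proof.
move=> fa; rewrite mxE.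
rewrite (_ : (fun t => _) = fun t => \sum_i f t 0 i * M i j); last first.
  by apply/funext => t; rewrite mxE.
apply: cvg_big => [|i _]; first exact: add_continuous.
by apply: cvgM; [exact: cvg_coord|exact: cvg_cst].
Qed.

End Closure.

(** * Isometry of the rotation, gradient threshold and choice of the weight *)

Section RotationBounds.
Context {R : realType} {n : nat}.

Lemma enorm_rot (v : 'rV[R]_(n + n)) : enorm (v *m rot_mx) = enorm v.
Proof.
rewrite !enormE dotrv_mull -mulmxA.
suff -> : @rot_mx R n *m rot_mx^T = 1%:M by rewrite mulmx1.
rewrite rot_mx_skew /rot_mx opp_block_mx mulmx_block !oppr0 opprK.
rewrite !mulmx0 !mul0mx !addr0 !add0r mulNmx mulmxN !mulmx1 opprK.
by rewrite scalar_mx_block.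
Qed.

End RotationBounds.

(** Here [d] stands for the norm of Du. If [d > L], then [1 <= W <= 2 * d], so the first three terms
    are at least [- C0 * gam * W ^+ 2], hence at least [- 4 * C0 * gam * d ^+ 2]. [K] is chosen so
    that [K * eps ^+ 2 = 4 * C0 + eps ^+ 2], which makes the sum positive. *)
Lemma gradient_threshold {R : realFieldType} (eps M X L K : R)
    (d W gam dh h vx jx sigma : R) :
  eps != 0 -> 0 <= M -> 0 <= X -> L = `|eps| + X + 1 ->
  K = 4 * (2 * M + M * (eps ^+ 2 + X) + 2 * X) / eps ^+ 2 + 1 ->
  0 <= sigma <= 1 -> 1 <= gam -> 0 <= d -> W <= `|eps| + X + d -> d - X <= W ->
  `|dh| <= M * W -> `|h| <= M -> `|vx| <= W * X -> `|jx| <= W * X ->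
  2 * W * (sigma * dh) + gam * (sigma * h) * W * (eps ^+ 2 + sigma * vx)
    - 2 * gam * sigma ^+ 2 * jx + K * gam * eps ^+ 2 * d ^+ 2 <= 0 ->
  d <= L.
Proof.
move=> eps0 M0 X0 LE KE /andP[s0 s1] gam1 d0 Wd dW dhb hb vxb jxb ineq.
rewrite leNgt; apply/negP => Ld.
have e2 : 0 < eps ^+ 2 by rewrite exprn_even_gt0.
have ea := normr_ge0 eps.
have W1 : 1 <= W by lra.
have W0 : 0 <= W by lra.
have W2 : W <= 2 * d by lra.
have gam0 : 0 <= gam by lra.
have WW : W <= W ^+ 2 by rewrite expr2 ler_peMr.
have W4 : W ^+ 2 <= 4 * d ^+ 2.
  by rewrite (_ : 4 * d ^+ 2 = (2 * d) ^+ 2) ?ler_pXn2r ?nnegrE ?mulr_ge0 //; ring.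
have shb : `|sigma * h| <= M.
  by rewrite normrM (ger0_norm s0) -[M]mul1r ler_pM.
have sdhb : `|sigma * dh| <= M * W.
  by rewrite normrM (ger0_norm s0) -[M * W]mul1r ler_pM.
have svxb : `|sigma * vx| <= W * X.
  by rewrite normrM (ger0_norm s0) -[W * X]mul1r ler_pM.
have sjxb : `|sigma ^+ 2 * jx| <= W * X.
  by rewrite normrM ger0_norm ?sqr_ge0 // -[W * X]mul1r ler_pM ?sqr_ge0 ?expr_le1.
have t1 : - (2 * M * (gam * W ^+ 2)) <= 2 * W * (sigma * dh).
  move: sdhb; rewrite ler_norml => /andP[l _].
  (* The term with [dh] carries no [gam]; [1 <= gam] supplies it. *)
  have := ler_wpM2l W0 l; have := ler_wpM2r (mulr_ge0 M0 (sqr_ge0 W)) gam1; lra.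
have t2 : - (M * (eps ^+ 2 + X) * (gam * W ^+ 2))
    <= gam * (sigma * h) * W * (eps ^+ 2 + sigma * vx).
  have b1 : `|eps ^+ 2 + sigma * vx| <= (eps ^+ 2 + X) * W.
    apply: le_trans (ler_normD _ _) _; rewrite (ger0_norm (ltW e2)).
    by have := ler_wpM2l (ltW e2) W1; lra.
  have : `|(sigma * h) * (eps ^+ 2 + sigma * vx)| <= M * ((eps ^+ 2 + X) * W).
    by rewrite normrM ler_pM.
  rewrite ler_norml => /andP[l _].
  by have := ler_wpM2l (mulr_ge0 gam0 W0) l; lra.
have t3 : - (2 * X * (gam * W ^+ 2)) <= - 2 * gam * sigma ^+ 2 * jx.
  move: sjxb; rewrite ler_norml => /andP[_ l].
  have l2 : sigma ^+ 2 * jx <= W ^+ 2 * X by have := ler_wpM2r X0 WW; lra.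
  by have := ler_wpM2l gam0 l2; lra.
pose C0 := 2 * M + M * (eps ^+ 2 + X) + 2 * X.
have C00 : 0 <= C0 by rewrite /C0 !addr_ge0 ?mulr_ge0 ?addr_ge0 // ltW.
have KeE : K * eps ^+ 2 = 4 * C0 + eps ^+ 2 by rewrite KE /C0; field; exact: eps0.
have main : (4 * C0 + eps ^+ 2) * (gam * d ^+ 2) <= C0 * (gam * W ^+ 2).
  by rewrite -KeE /C0; lra.
have W4g := ler_wpM2l C00 (ler_wpM2l gam0 W4).
have : 0 < eps ^+ 2 * (gam * d ^+ 2).
  by rewrite mulr_gt0 // mulr_gt0 ?exprn_gt0 //; lra.
by lra.
Qed.

(** [ln G] is [exp(K(s + N))], whose derivative [gam] is reproduced up to the factor [K] by
    differentiation. The shift by [N] makes the exponent nonnegative on the range of [u]. *)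
Lemma double_exp_weight {R : realType} (N K : R) : 0 <= K ->
  exists G gam : R -> R,
    [/\ forall s : R, is_derive s (1 : R) G (gam s * G s),
        forall s : R, is_derive s (1 : R) gam (K * gam s),
        forall s, 1 <= G s, {homo G : x y / x <= y} &
        forall s, 0 <= gam s /\ (- N <= s -> K <= gam s)].
Proof.
move=> K0; pose g (s : R) := expR (K * (s + N)).
have dg (s : R) : is_derive s (1 : R) g (K * g s).
  have dl : is_derive s (1 : R) (fun s : R => K * (s + N)) K.
    have did : is_derive s (1 : R) (fun x : R => x) 1 by exact: is_derive_id.
    have dcst : is_derive s (1 : R) (fun=> N) 0 by exact: is_derive_cst.
    by have := is_deriveZf K (is_deriveDf did dcst); rewrite addr0 mulr1.
  by rewrite mulrC; apply: is_derive1_comp.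
exists (fun s => expR (g s)), (fun s => K * g s); split.
- by move=> s; rewrite mulrC; apply: is_derive1_comp.
- by move=> s; exact: is_deriveZf.
- by move=> s; rewrite -expR0 ler_expR expR_ge0.
- by move=> x y xy; rewrite ler_expR /g ler_expR ler_wpM2l // lerD2r.
- move=> s; split; first by rewrite mulr_ge0 // expR_ge0.
  move=> Ns; rewrite -[leLHS]mulr1 ler_wpM2l // /g -[leLHS]expR0 ler_expR mulr_ge0 //.
  lra.
Qed.

(** * The global gradient estimate *)

Theorem theorem4p2 (R : realType) (n : nat) (hn : (1 <= n)%N)
  (eps : R) (heps : eps != 0) (Mu MH MX : R) :
  exists C : R, 0 < C /\
  forall (Om : set 'rV[R]_(n + n)) (H : 'rV[R]_(n + n) -> R)
         (GH : 'rV[R]_(n + n) -> 'rV[R]_(n + n)) (sigma : R)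
         (u : 'rV[R]_(n + n) -> R) (Gu : 'rV[R]_(n + n) -> 'rV[R]_(n + n)),
    bounded_domain Om ->
    C1bar Om H GH ->
    0 <= sigma <= 1 ->
    Ck 3 Om u ->
    C1bar Om u Gu ->
    (forall z, Om z ->
       divg (fun w => (Num.sqrt (eps ^+ 2 + esq (grad u w + sigma *: Xf w)))^-1
                        *: (grad u w + sigma *: Xf w)) z = sigma * H z) ->
    (* ||u||_{L^oo(Om)} <= Mu *)
    (forall z, Om z -> `|u z| <= Mu) ->
    (* ||H||_{C^1(closure Om)} = sup |H| + sup |DH| <= MH *)
    (forall w1 w2, closure Om w1 -> closure Om w2 -> `|H w1| + enorm (GH w2) <= MH) ->
    (* ||X||_{L^oo(Om)} <= MX *)
    (forall z, Om z -> enorm (Xf z) <= MX) ->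
    (* for every bound B of |Du| on the boundary (in particular the sup) *)
    forall B : R, (forall w, (closure Om `\` Om) w -> enorm (Gu w) <= B) ->
    forall z, Om z -> enorm (grad u z) <= C * (B + 1).
Proof.
(* Absolute values make the constants nonnegative for arbitrary real [Mu], [MH], [MX]. *)
pose M := `|MH|; pose X := `|MX|; pose N := `|Mu|.
pose L := `|eps| + X + 1.
pose K := 4 * (2 * M + M * (eps ^+ 2 + X) + 2 * X) / eps ^+ 2 + 1.
have M0 : 0 <= M by exact: normr_ge0.
have X0 : 0 <= X by exact: normr_ge0.
have K1 : 1 <= K.
  have e0 := sqr_ge0 eps; rewrite /K lerDr divr_ge0 // mulr_ge0 //.
  by have := mulr_ge0 M0 e0; have := mulr_ge0 M0 X0; lra.
have K0 : 0 <= K by lra.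
have [G [gam [dG dgam G1 homoG gamK]]] := double_exp_weight N K0.
have G_gt0 s : 0 < G s by have := G1 s; lra.
pose Q := L + X + `|eps|.
have Q0 : 0 <= Q by rewrite /Q /L !addr_ge0.
(* The argument ends with [enorm (Gu z) <= G N * (Q + B) + X]; since [1 <= G N] and [0 <= B], this
   is at most [G N * (Q + X + 1) * (B + 1)]. *)
exists (G N * (Q + X + 1)).
split; first by rewrite mulr_gt0 // ltr_wpDl // addr_ge0.
move=> Om H GH sigma u Gu [Om0 [oOm [_ bOm]]] [C1H [_ [_ GHE]]] s01 C3u
  [_ [cu [cGu GuE]]] eqn ub Hb Xb B Bb z Omz.
have Hb' y : Om y -> `|H y| <= M /\ enorm (grad H y) <= M.
  move=> Omy; have := Hb y y (subset_closure Omy) (subset_closure Omy).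
  rewrite GHE // => h; have := ler_norm MH; have := normr_ge0 (H y).
  by have := enorm_ge0 (grad H y); rewrite -/M; split; lra.
have cXf i (y : subspace (closure Om)) :
    (fun w => Xf w 0 i) @ nbhs y --> Xf (y : 'rV[R]_(n + n)) 0 i.
  rewrite XfE (_ : (fun w => _) = fun w => (w *m rot_mx^T) 0 i); last first.
    by apply/funext => w; rewrite XfE.
  have cid : {within closure Om, continuous (fun w : 'rV[R]_(n + n) => w)}.
    by apply: continuous_subspaceT => w; exact: cvg_id.
  by apply: cvg_mulmx_coord; exact: cid.
have cenormX : {within closure Om, continuous (fun y => enorm (Xf y))}.
  move=> y; rewrite (_ : (fun y => _) = Num.sqrt \o (fun y => dotrv (Xf y) (Xf y))).
    apply: (@continuous_comp (subspace (closure Om)) _ _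
      (fun y => dotrv (Xf y) (Xf y)) Num.sqrt); last exact: sqrt_continuous.
    by apply: cvg_dotrv => i; exact: cXf.
  by apply/funext => w; rewrite enormE.
have XclX y : closure Om y -> enorm (Xf y) <= X.
  by apply: (closure_le cenormX) => w Omw; apply: le_trans (Xb w Omw) _; exact: ler_norm.
have ucl y : closure Om y -> u y <= N.
  apply: (closure_le cu) => w Omw.
  by apply: le_trans (ler_norm _) _; apply: le_trans (ub w Omw) _; exact: ler_norm.
(* [Gu] replaces [grad u] so that [P] is continuous on the compact closure and the maximum is
   attained. *)
pose V y := Gu y + sigma *: Xf y.
pose P y := eps ^+ 2 + dotrv (V y) (V y).
have [z0 cz0 maxz0] : exists2 c, c \in closure Om &
    forall t, t \in closure Om -> P t * G (u t) <= P c * G (u c).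
  apply: compact_EVT_max.
  - by exists z; exact: subset_closure.
  - by apply: bounded_closed_compact; [exact: bounded_closure|exact: closed_closure].
  move=> y; apply: cvgM.
    apply: cvgD; first exact: cvg_cst.
    have cV i : (fun w : subspace (closure Om) => V w 0 i) @ nbhs y --> V y 0 i.
      have VE w : V w 0 i = Gu w 0 i + sigma * Xf w 0 i.
        by rewrite mxE [X in _ + X]mxE.
      rewrite VE (_ : (fun w => _) = fun w => Gu w 0 i + sigma * Xf w 0 i).
        apply: cvgD; first by apply: cvg_coord; exact: cGu.
        by apply: cvgM; [exact: cvg_cst|exact: cXf].
      by apply/funext => w; exact: VE.
    by apply: cvg_dotrv => i; exact: cV.
  apply: (@continuous_comp (subspace (closure Om)) _ _ u G); first exact: cu.
  by apply/differentiable_continuous/derivable1_diffP; case: (dG (u y)).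
rewrite inE in cz0.
have B0 : 0 <= B.
  have m0 : (0 < n + n)%N by rewrite addn_gt0 hn.
  have [w bw] := boundary_nonempty m0 Om0 oOm bOm.
  exact: le_trans (enorm_ge0 _) (Bb w bw).
have PE y : P y = eps ^+ 2 + enorm (V y) ^+ 2 by rewrite enorm_sqr.
have sX y : closure Om y -> enorm (sigma *: Xf y) <= X.
  move=> cly; rewrite enormZ; case/andP: s01 => s0 s1.
  by rewrite (ger0_norm s0) -[X]mul1r ler_pM ?enorm_ge0 // XclX.
have VG y : closure Om y ->
    enorm (V y) <= enorm (Gu y) + X /\ enorm (Gu y) <= enorm (V y) + X.
  move=> cly; split.
    have := enormD (Gu y) (sigma *: Xf y); have := sX y cly.
    by rewrite -/(V y); lra.
  have := enormD (V y) ((-1) *: (sigma *: Xf y)); rewrite enormZ normrN1 mul1r.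
  by rewrite scaleN1r /V addrK; have := sX y cly; lra.
(* [L] covers an interior maximum, [B] one on the boundary. *)
have z0_bound : enorm (Gu z0) <= L + B.
  have [Omz0|nOmz0] := pselect (Om z0); last first.
    have := Bb z0 (conj cz0 nOmz0); have : 0 <= L by rewrite /L !addr_ge0.
    lra.
  suff : enorm (Gu z0) <= L by lra.
  have nOm : \forall y \near z0, Om y by apply: open_nbhs_nbhs.
  have cOmz0 := subset_closure Omz0.
  have maxOm : \forall y \near z0,
      (eps ^+ 2 + dotrv (grad u y + sigma *: Xf y) (grad u y + sigma *: Xf y)) * G (u y)
      <= (eps ^+ 2 + dotrv (grad u z0 + sigma *: Xf z0) (grad u z0 + sigma *: Xf z0))
         * G (u z0).
    near=> y; have Omy : Om y by near: y.
    have := maxz0 y; rewrite inE /P /V !GuE //; apply; exact: subset_closure.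
  have := bernstein_inequality oOm heps C3u C1H eqn dG dgam G_gt0
    (fun s => (gamK s).1) K0 Omz0 maxOm.
  have [hb dhb] := Hb' z0 Omz0.
  have [VGz GVz] := VG z0 cOmz0.
  have Xz := XclX z0 cOmz0.
  move: VGz GVz; rewrite /V GuE // -enorm_sqr.
  set Vz := grad u z0 + sigma *: Xf z0 => VGz GVz.
  have Vz0 := enorm_ge0 Vz; have ea := normr_ge0 eps.
  have VW : enorm Vz <= Num.sqrt (eps ^+ 2 + enorm Vz ^+ 2).
    rewrite -{1}(ger0_norm Vz0) -sqrtr_sqr ler_wsqrtr //.
    by rewrite lerDr sqr_ge0.
  have WV : Num.sqrt (eps ^+ 2 + enorm Vz ^+ 2) <= `|eps| + enorm Vz.
    rewrite -(@ler_pXn2r _ 2) ?nnegrE ?sqrtr_ge0 ?addr_ge0 //.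
    rewrite sqr_sqrtr ?addr_ge0 ?sqr_ge0 // sqrrD real_normK ?num_real //.
    by have := mulr_ge0 ea Vz0; lra.
  have WX w : enorm w = enorm Vz -> `|dotrv w (Xf z0)|
      <= Num.sqrt (eps ^+ 2 + enorm Vz ^+ 2) * X.
    move=> wV; apply: le_trans (dotrv_le_enorm _ _) _.
    by rewrite ler_pM ?enorm_ge0 // wV.
  rewrite -[dotrv (grad u z0) _]enorm_sqr.
  apply: (@gradient_threshold R eps M X L K) => //.
  (* [u z0 >= - N], so [gam (u z0) >= K >= 1]. *)
  - apply: le_trans K1 ((gamK (u z0)).2 _).
    have := ub z0 Omz0; have := ler_norm Mu.
    by rewrite -/N ler_norml => /[swap] /andP[]; lra.
  - exact: enorm_ge0.
  - by lra.
  - by lra.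
  - apply: le_trans (dotrv_le_enorm _ _) _.
    by rewrite mulrC ler_pM ?enorm_ge0.
  - exact: WX.
  - by apply: WX; rewrite enorm_rot.
have clz := subset_closure Omz.
have := maxz0 z; rewrite !inE => /(_ clz) Pz.
(* [enorm (V z0) <= L + B + X], and the sum of the squares of this bound and of [eps] is at most the
   square of the sum; hence [Q]. *)
have Pz0 : P z0 <= (Q + B) ^+ 2.
  have [l _] := VG z0 cz0; have v0 := enorm_ge0 (V z0).
  have l2 : enorm (V z0) <= L + B + X by lra.
  have ea := normr_ge0 eps; have L0 : 0 <= L by rewrite /L !addr_ge0.
  have l3 : enorm (V z0) ^+ 2 <= (L + B + X) ^+ 2.
    by rewrite ler_pXn2r ?nnegrE ?addr_ge0.
  have := mulr_ge0 ea (addr_ge0 (addr_ge0 L0 B0) X0).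
  have : eps ^+ 2 = `|eps| ^+ 2 by rewrite real_normK ?num_real.
  by rewrite PE /Q; lra.
have Pz0_ge0 : 0 <= P z0 by rewrite /P addr_ge0 ?sqr_ge0 ?dotrv_ge0.
have GN := G1 N; have QB : 0 <= Q + B by rewrite addr_ge0.
(* Maximality at [z0], with [G >= 1] at [z] and [G <= G N] at [z0]; bounding [G N] by its square
   avoids a square root. *)
have Vz : enorm (V z) <= G N * (Q + B).
  rewrite -(@ler_pXn2r _ 2) ?nnegrE ?mulr_ge0 ?enorm_ge0 //; last by lra.
  have P_le : P z <= P z * G (u z).
    by rewrite ler_peMr // /P addr_ge0 ?sqr_ge0 ?dotrv_ge0.
  have P0_le : P z0 * G (u z0) <= (Q + B) ^+ 2 * G N.
    by rewrite ler_pM ?(ltW (G_gt0 _)) // homoG // ucl.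
  have GG : (Q + B) ^+ 2 * G N <= (G N * (Q + B)) ^+ 2.
    by rewrite exprMn mulrC ler_wpM2r ?sqr_ge0 // expr2 ler_peMr //; lra.
  by have := PE z; have := sqr_ge0 eps; lra.
have [_] := VG z clz; rewrite GuE // => gV.
have GX : X <= G N * X by rewrite ler_peMl.
have := mulr_ge0 (mulr_ge0 (ltW (G_gt0 N)) (addr_ge0 Q0 X0)) B0.
have := mulr_ge0 (ltW (G_gt0 N)) B0.
have := G_gt0 N.
lra.
Unshelve. all: by end_near. Qed.
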